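(* Let $(\mathcal{R},\leq,r)$ be a \textbf{wA2}-space such that $\mathcal{AR}$ is countable. Then: (1) Every analytic subset of $\mathcal{R}$ is Kastanas Ramsey. (2) If every coanalytic subset of $\mathcal{R}\times2^\omega$ is Kastanas Ramsey, then every $\mathbf{\Sigma}^1_2$ subset of $\mathcal{R}$ is Kastanas Ramsey. More generally, for every $n\ge1$, if every $\mathbf{\Pi}^1_n$ subset of $\mathcal{R}\times2^\omega$ is Kastanas Ramsey, then every $\mathbf{\Sigma}^1_{n+1}$ subset of $\mathcal{R}$ is Kastanas Ramsey.
   Context: $\mathcal{R}$ nonempty, $\le$ quasi-order on $\mathcal{R}$, $r:\mathcal{R}\times\omega\to\mathcal{AR}$, $r_n(A):=r(A,n)$, $\mathcal{AR}_n$ the image of $r_n$. A1: (1) $r_0(A)=\emptyset$; (2) $A\ne B\Rightarrow r_n(A)\ne r_n(B)$ for some $n$; (3) $r_n(A)=r_m(B)\Rightarrow n=m$ and $r_k(A)=r_k(B)$ for $k<n$. $\mathrm{lh}(a)$: the $n$ with $a\in\mathcal{AR}_n$; $a\sqsubseteq b$ iff $a=r_m(A)$, $b=r_n(A)$ for some $A$, $m\le n$. wA2: a quasi-order $\leq_{\mathrm{fin}}$ on $\mathcal{AR}$ with (w1) $\{a:a\leq_{\mathrm{fin}}b\}$ countable; (2) $A\le B$ iff $\forall n\exists m\ r_n(A)\leq_{\mathrm{fin}}r_m(B)$; (3) $a\sqsubseteq b\leq_{\mathrm{fin}}c\Rightarrow\exists d\sqsubseteq c\ a\leq_{\mathrm{fin}}d$.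 $[a,A]=\{B\le A:\exists n\ r_n(B)=a\}$; $[n,A]=[r_n(A),A]$; $\mathrm{depth}_B(a)=\min\{n:a\leq_{\mathrm{fin}}r_n(B)\}$ or $\infty$; $\mathcal{AR}{\upharpoonright}A=\{a:\exists n\ a\leq_{\mathrm{fin}}r_n(A)\}$; $r_n[a,A]=\{b\in\mathcal{AR}{\upharpoonright}A:a\sqsubseteq b,\mathrm{lh}(b)=n\}$. A3: (1) $\mathrm{depth}_B(a)<\infty\Rightarrow[a,A]\ne\emptyset$ for all $A\in[\mathrm{depth}_B(a),B]$; (2) $A\le B$, $[a,A]\ne\emptyset\Rightarrow\exists A'\in[\mathrm{depth}_B(a),B]$ with $\emptyset\ne[a,A']\subseteq[a,A]$. A \textbf{wA2}-space: A1, wA2, A3 hold and $\mathcal{R}$ (identified with $\{(r_n(A))_n\}$) is closed in $\mathcal{AR}^{\mathbb N}$. Topology: first-difference metric $d(A,B)=2^{-n}$, $n$ least with $r_n(A)\ne r_n(B)$ (Polish when $\mathcal{AR}$ is countable); $\mathcal{R}\times2^\omega$ carries the product topology. The \textbf{wA2}-space $(\mathcal{R}\times2^\omega,\preceq,r)$: approximations $\bigcup_n\mathcal{AR}_n\times2^n$; $r_n(A,u):=(r_n(A),u{\upharpoonright}n)$; $(a,p)\preceq_{\mathrm{fin}}(b,q)$ iff $a\leq_{\mathrm{fin}}b$; $(A,u)\preceq(B,v)$ iff $\forall n\exists m\ r_n(A,u)\preceq_{\mathrm{fin}}r_m(B,v)$. Kastanas Ramsey subsets of $\mathcal{R}\times2^\omega$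 refer to this space. Kastanas game $K[a,A]$: with $a_0=a$, $B_{-1}=A$, in round $n\ge0$ I plays $A_n\in[a_n,B_{n-1}]$, then II plays $a_{n+1}\in r_{\mathrm{lh}(a_n)+1}[a_n,A_n]$ and $B_n\in[a_{n+1},A_n]$; outcome: the element $B$ with $r_{\mathrm{lh}(a)+n}(B)=a_n$ for all $n$. $\mathcal{X}$ is Kastanas Ramsey if for all $A$ and $a\in\mathcal{AR}{\upharpoonright}A$ there is $B\in[a,A]$ such that I has a strategy in $K[a,B]$ ensuring the outcome lies in $\mathcal{X}^c$, or II has a strategy in $K[a,B]$ ensuring the outcome lies in $\mathcal{X}$. *)

(* Defs.v *)
From HB Require Import structures.
From mathcomp Require Import all_boot all_order all_algebra.
From mathcomp Require Import all_classical.
From mathcomp Require Import topology cantor.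

Set Implicit Arguments.
Unset Strict Implicit.
Unset Printing Implicit Defensive.

Import Order.TTheory GRing.Theory Num.Theory.

Local Open Scope classical_set_scope.
Local Open Scope ring_scope.

(* The bare data of a space (R, <=, r), including the quasi-order <=_fin on
   AR; the axioms are in [wA2_space].  [r A n] is r_n(A). *)
Record approx_space := ApproxSpace {
  carrier : Type ;
  approx : Type ;
  leR : carrier -> carrier -> Prop ;
  lefin : approx -> approx -> Prop ;
  r : carrier -> nat -> approx
}.

HB.instance Definition _ (S : approx_space) := gen_eqMixin (carrier S).
HB.instance Definition _ (S : approx_space) := gen_choiceMixin (carrier S).
HB.instance Definition _ (S : approx_space) := gen_eqMixin (approx S).
HB.instance Definition _ (S : approx_space) := gen_choiceMixin (approx S).

Section Approximations.
Variable S : approx_space.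
Implicit Types (A B : carrier S) (a b : approx S) (n : nat).

Definition AR_ n : set (approx S) := range (fun A => r A n).

Definition lh a : nat := xget 0%N [set n | AR_ n a].

Definition initial a b : Prop :=
  exists A m n, [/\ (m <= n)%N, a = r A m & b = r A n].

(* [basic a A] is [a, A]. *)
Definition basic a A : set (carrier S) :=
  [set B | leR B A /\ exists n, r B n = a].

(* [basic_nat n A] is [n, A]. *)
Definition basic_nat n A : set (carrier S) := basic (r A n) A.

(* [None] stands for infinite depth. *)
Definition depth B a : option nat :=
  if pselect (exists n, `[< lefin a (r B n) >]) is left h
  then Some (ex_minn h) else None.

(* AR restricted to A *)
Definition AR_below A : set (approx S) := [set a | exists n, lefin a (r A n)].

(* [extensions n a A] is r_n[a, A]. *)
Definition extensions n a A : set (approx S) :=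
  [set b | [/\ AR_below A b, initial a b & lh b = n]].

End Approximations.

(* First-difference metric.  It separates points only under axiom A1, hence
   the pseudometric structure on the bare data. *)
Section FirstDifference.
Variable S : approx_space.
Implicit Types A B C : carrier S.

Definition first_diff A B : rat :=
  if pselect (exists n, `[< r A n <> r B n >]) is left h
  then 2 ^- (ex_minn h) else 0.

Let first_diff_xx A : first_diff A A = 0.
Proof. by rewrite /first_diff; case: pselect => // h; exfalso; case: h => n /asboolP. Qed.

Let first_diff_sym A B : first_diff A B = first_diff B A.
Proof.
rewrite /first_diff; case: pselect => [h|h]; case: pselect => [h'|h'] //.
- congr (2 ^- _); case: ex_minnP => m /asboolP hm mP.
  case: ex_minnP => k /asboolP hk kP; apply/eqP; rewrite eqn_leq.
  by apply/andP; split; [apply: mP | apply: kP]; apply/asboolP => /esym.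
- by case: h' ; case: h => n /asboolP hn; exists n; apply/asboolP => /esym.
- by case: h ; case: h' => n /asboolP hn; exists n; apply/asboolP => /esym.
Qed.

Let first_diff_ge0 A B : 0 <= first_diff A B.
Proof. by rewrite /first_diff; case: pselect => // h; rewrite invr_ge0 exprn_ge0. Qed.

Let first_diff_triangle B A C :
  first_diff A C <= first_diff A B + first_diff B C.
Proof.
rewrite {1}/first_diff; case: pselect => [h|_]; last by rewrite addr_ge0.
case: ex_minnP => m /asboolP hm _.
have key (A' B' : carrier S) :
    r A' m <> r B' m -> 2 ^- m <= first_diff A' B'.
  move=> d; rewrite /first_diff; case: pselect => [h'|[]]; last first.
    by exists m; apply/asboolP.
  case: ex_minnP => k _ kP; have km : (k <= m)%N by apply/kP/asboolP.
  by rewrite lef_pV2 ?posrE ?exprn_gt0// ler_eXn2l.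
have [eAB|/key dAB] := pselect (r A m = r B m).
  by rewrite ler_wpDl// key// -eAB.
by rewrite ler_wpDr.
Qed.

Definition first_diff_ball A (e : rat) : set (carrier S) :=
  [set B | first_diff A B < e].

Let ent : set_system (carrier S * carrier S) := entourage_ first_diff_ball.

HB.instance Definition _ := hasNbhs.Build (carrier S) (nbhs_ ent).

Let nbhsE : @nbhs _ (carrier S) = nbhs_ ent. Proof. by []. Qed.

Let ball_center A (e : rat) : 0 < e -> first_diff_ball A e A.
Proof. by rewrite /first_diff_ball /= first_diff_xx. Qed.

Let ball_sym A B (e : rat) : first_diff_ball A e B -> first_diff_ball B e A.
Proof. by rewrite /first_diff_ball /= first_diff_sym. Qed.

Let ball_triangle A B C (e1 e2 : rat) :
  first_diff_ball A e1 B -> first_diff_ball B e2 C ->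
  first_diff_ball A (e1 + e2) C.
Proof.
rewrite /first_diff_ball /= => h1 h2.
by apply: le_lt_trans (first_diff_triangle B A C) _; rewrite ltrD.
Qed.

HB.instance Definition _ := @Nbhs_isPseudoMetric.Build rat (carrier S)
  ent nbhsE first_diff_ball ball_center ball_sym ball_triangle erefl.

End FirstDifference.

Record wA2_space (S : approx_space) : Prop := {
  wA2_inhabited : inhabited (carrier S) ;
  leR_refl : forall A : carrier S, leR A A ;
  leR_trans : forall A B C : carrier S, leR A B -> leR B C -> leR A C ;

  (* AR is the union of the AR_n, so that lh is defined everywhere. *)
  AR_union : forall a : approx S, exists n, AR_ n a ;
  A1_1 : exists a0 : approx S, forall A, r A 0 = a0 ;
  A1_2 : forall A B : carrier S, A <> B -> exists n, r A n <> r B n ;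
  A1_3 : forall (A B : carrier S) n m, r A n = r B m ->
    n = m /\ forall k, (k < n)%N -> r A k = r B k ;

  lefin_refl : forall a : approx S, lefin a a ;
  lefin_trans : forall a b c : approx S, lefin a b -> lefin b c -> lefin a c ;
  wA2_1 : forall b : approx S, countable [set a | lefin a b] ;
  wA2_2 : forall A B : carrier S,
    leR A B <-> forall n, exists m, lefin (r A n) (r B m) ;
  wA2_3 : forall a b c : approx S, initial a b -> lefin b c ->
    exists2 d, initial d c & lefin a d ;

  A3_1 : forall (B : carrier S) a n, depth B a = Some n ->
    forall A, basic_nat n B A -> basic a A !=set0 ;
  A3_2 : forall (A B : carrier S) a, leR A B -> basic a A !=set0 ->
    exists2 n, depth B a = Some n &
    exists2 A', basic_nat n B A' &
      basic a A' !=set0 /\ basic a A' `<=` basic a A ;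

  wA2_closed : closed
    (range (@r S : carrier S ->
      prod_topology (fun _ : nat => discrete_topology (approx S))))
}.

(* A run of K[a, A] consists of I's moves [y n] = A_n and II's moves
   [x n] = (a_{n+1}, B_n).  A strategy is a function of the opponent's moves so
   far; it has to answer legally as long as the opponent has played legally. *)
Section KastanasGame.
Variable S : approx_space.
Implicit Types (A B : carrier S) (a : approx S) (X : set (carrier S)).
Implicit Types (x : nat -> approx S * carrier S) (y : nat -> carrier S).

(* a_n *)
Definition stem a x n : approx S := if n is m.+1 then (x m).1 else a.

(* B_{n-1} *)
Definition side A x n : carrier S := if n is m.+1 then (x m).2 else A.

Definition legalI a A x y n : Prop := basic (stem a x n) (side A x n) (y n).

Definition legalII a x y n : Prop :=
  extensions (lh (stem a x n)).+1 (stem a x n) (y n) (x n).1 /\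
  basic (x n).1 (y n) (x n).2.

Definition outcome a x B : Prop := forall n, r B (lh a + n) = stem a x n.

Definition strategyI_ensures a A (sigma : seq (approx S * carrier S) -> carrier S)
    X : Prop :=
  forall x, let y := fun n => sigma (mkseq x n) in
  (forall n, (forall i, (i < n)%N -> legalII a x y i) -> legalI a A x y n) /\
  ((forall n, legalII a x y n) -> exists2 B, outcome a x B & X B).

Definition strategyII_ensures a A (tau : seq (carrier S) -> approx S * carrier S)
    X : Prop :=
  forall y, let x := fun n => tau (mkseq y n.+1) in
  (forall n, (forall i, (i <= n)%N -> legalI a A x y i) -> legalII a x y n) /\
  ((forall n, legalI a A x y n) -> exists2 B, outcome a x B & X B).

Definition Kastanas_Ramsey X : Prop :=
  forall A a, AR_below A a -> exists2 B, basic a A B &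
    (exists sigma, strategyI_ensures a B sigma (~` X)) \/
    (exists tau, strategyII_ensures a B tau X).

End KastanasGame.

(* The space (R x 2^omega, preceq, r); the approximations are the pairs (a, p)
   with a in AR_n and p in 2^n, a finite binary sequence of length n. *)
Section CantorProduct.
Variable S : approx_space.

Definition prod_approx : Type :=
  [set ap : approx S * seq bool | AR_ (size ap.2) ap.1].

Lemma prod_r_subproof (Au : carrier S * cantor_space) n :
  (r Au.1 n, mkseq Au.2 n) \in
    [set ap : approx S * seq bool | AR_ (size ap.2) ap.1].
Proof. by rewrite inE /= size_mkseq; exists Au.1. Qed.

Definition prod_r (Au : carrier S * cantor_space) n : prod_approx :=
  exist _ (r Au.1 n, mkseq Au.2 n) (prod_r_subproof Au n).

Definition prod_lefin (ap bq : prod_approx) : Prop :=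
  lefin (val ap).1 (val bq).1.

Definition prod_le (Au Bv : carrier S * cantor_space) : Prop :=
  forall n, exists m, prod_lefin (prod_r Au n) (prod_r Bv m).

Definition prod_space : approx_space :=
  ApproxSpace prod_le prod_lefin prod_r.

End CantorProduct.

Definition baire_space : Type := prod_topology (fun _ : nat => nat).
HB.instance Definition _ := Topological.on baire_space.

(* Boldface projective classes, with Sigma^1_0 the class of open sets: the
   Sigma^1_(n+1) sets are the projections along the Baire space of the sets
   whose complement is Sigma^1_n.  Thus Sigma^1_1 sets are the projections of
   closed subsets of X x omega^omega. *)
Fixpoint Sigma11 (n : nat) (X : topologicalType) (E : set X) : Prop :=
  if n is m.+1 then
    exists2 F : set (X * baire_space), Sigma11 m (~` F) & E = fst @` F
  else open E.

Definition Pi11 (n : nat) (X : topologicalType) (E : set X) : Prop :=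
  Sigma11 n (~` E).

Definition analytic (X : topologicalType) (E : set X) : Prop := Sigma11 1 E.

Definition coanalytic (X : topologicalType) (E : set X) : Prop :=
  analytic (~` E).

(* Main.v *)
(** Player I can follow several of his winning strategies at once: he refines
    his move successively, so that it lies below what each of them prescribes,
    and feeds to each strategy, as II's previous move, the set that he had
    reached just before consulting it.

    Projections.  In the game on R x 2^omega player II plays the same moves and
    in addition one bit per round.  At round n only finitely many bit sequences
    are possible, so I can follow winning strategies against all of them, and
    the outcome avoids the whole projection.  A winning strategy of II projects
    by forgetting the bits.

    Analytic sets.  Let E be the projection of a closed F and let E_s be the
    projection of the part of F above s in omega^{<omega}; so E_s is the union
    of the E_{sk}.  Call (a, A) bad for s if I does not win against E_s from any
    A' in [a, A].  If (a, A) is bad for s, then II can reach in finitely many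
    rounds a position bad for some sk: otherwise I avoids these positions
    forever (this reachability game is open for II), and at round n begins to
    follow a strategy against E_{sn}, so that he wins against E_s.  Iterating,
    II produces an x in omega^omega along with the outcome B, and (B, x) lies in
    F because F is closed.

    Pi^1_n sets.  A Sigma^1_{n+1} set is a projection along omega^omega of a
    Pi^1_n set; coding omega^omega by elements of 2^omega, with an F_sigma set
    of invalid codes, turns it into a projection along 2^omega. *)
Require Import Defs.
From mathcomp Require Import all_boot all_order all_algebra all_classical.
From mathcomp Require Import topology cantor.

Set Implicit Arguments.
Unset Strict Implicit.
Unset Printing Implicit Defensive.

Import Order.TTheory GRing.Theory Num.Theory.

Local Open Scope classical_set_scope.

(** * Projective classes *)

Lemma cvg_prodP (I U : Type) (T : I -> topologicalType) (F : set_system U)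
    (f : U -> prod_topology T) (g : prod_topology T) :
  Filter F -> (forall i, f x i @[x --> F] --> g i) -> f @ F --> g.
Proof.
move=> FF fg; apply/cvg_sup => i A [V] [[W] oW <-] WgN WA.
by apply: filterS WA _; apply: fg; apply: open_nbhs_nbhs.
Qed.

Lemma continuous_prod (I : Type) (X : topologicalType) (T : I -> topologicalType)
    (f : X -> prod_topology T) :
  (forall i, continuous (fun x => f x i)) -> continuous f.
Proof. by move=> fc x; apply: cvg_prodP => i; exact: fc. Qed.

Lemma continuous_coord (I : eqType) (T : I -> topologicalType) (i : I) :
  continuous (fun f : prod_topology T => f i).
Proof. exact: proj_continuous. Qed.

Lemma cvg_prod_stable (T : topologicalType) (u : nat -> {ptws nat -> T})
    (x : {ptws nat -> T}) :
  (forall N i : nat, i < N -> u N i = x i) -> u @ \oo --> x.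
Proof.
move=> h; apply: cvg_prodP => i A xA; exists i.+1 => // N /= iN.
by rewrite h//; exact: nbhs_singleton.
Qed.

Lemma continuous_pair (X Y Z : topologicalType) (f : X -> Y) (g : X -> Z) :
  continuous f -> continuous g -> continuous (fun x => (f x, g x)).
Proof. by move=> fc gc x; apply: cvg_pair; [exact: fc|exact: gc]. Qed.

Lemma open_preimage_discrete (X : topologicalType) (T : discreteTopologicalType)
    (f : X -> T) (P : set T) :
  continuous f -> open (f @^-1` P).
Proof. by move=> /continuousP; apply; exact: discrete_open. Qed.


Lemma cvg_approx_stable (S : approx_space) (hS : wA2_space S)
    (u : nat -> carrier S) (A : carrier S) :
  (forall N, r (u N) N = r A N) -> u @ \oo --> A.
Proof.
move=> h; apply/cvg_ballP => e e0.
have [k ke] : exists k, (2 ^- k < e)%R.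
  exists (Num.truncn e^-1).+1.
  rewrite -[X in (_ < X)%R]invrK ltf_pV2 ?posrE ?exprn_gt0 ?invr_gt0//.
  apply: (@lt_trans _ _ ((Num.truncn e^-1).+1%:R)%R); last first.
    by rewrite -natrX ltr_nat ltn_expl.
  exact: truncnS_gt.
exists k => // N /= kN; suff : (Defs.first_diff A (u N) < e)%R by [].
rewrite /Defs.first_diff.
case: pselect => [d|_]; last exact: e0.
case: ex_minnP => m /asboolP rm _.
apply: (@le_lt_trans _ _ (2 ^- k)%R) => //.
rewrite lef_pV2 ?posrE ?exprn_gt0// ler_eXn2l//.
(* A first difference at [m < k] is impossible: by [A1_3] the agreement at level [N] passes down to
   every lower level. *)
rewrite leqNgt; apply/negP => mk; apply: rm; have [_ E] := A1_3 hS (h N).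
by rewrite E// (leq_trans mk).
Qed.

(** The open fibres of [c] partition the space, and the complement of a glued set is glued from the
    complements. So the induction passes through each alternation of complement and projection. *)
Lemma Sigma11_glue m (X : topologicalType) (T : Type) (c : X -> T)
    (E : T -> set X) :
  (forall k, open (c @^-1` [set k])) -> (forall k, Sigma11 m (E k)) ->
  Sigma11 m [set z | E (c z) z].
Proof.
elim: m X c E => [|m IH] X c E oc ES /=.
  rewrite [X in open X](_ : _ = \bigcup_k (c @^-1` [set k] `&` E k)).
    by apply: bigcup_open => k _; apply: openI; [exact: oc | exact: ES].
  by apply/seteqP; split => [z Ez|z [k _ [/= ->]]//]; exists (c z).
have [K KP] := choice (fun k => (let: ex_intro2 F FS EF := ES k in
  ex_intro (fun F => Sigma11 m (~` F) /\ E k = fst @` F) F (conj FS EF))).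
exists [set z | K (c z.1) z].
  apply: (IH _ (fun z => c z.1) (fun k => ~` K k)) => [k|k]; last by case: (KP k).
  have /continuousP fc : continuous (@fst X baire_space).
    by move=> z; exact: cvg_fst.
  by apply: (fc (c @^-1` [set k])); exact: oc.
apply/seteqP; split => [z /=|z [[z' y] /= Kz <-]].
  move=> Ez; have [_ EK] := KP (c z); move: Ez; rewrite EK => -[[z' y] /= Kz zE].
  by exists (z', y) => //=; move: Kz; rewrite -zE.
by case: (KP (c z')) => _ ->; exists (z', y).
Qed.

Lemma Sigma11_preimage m (X Y : topologicalType) (f : X -> Y) (E : set Y) :
  continuous f -> Sigma11 m E -> Sigma11 m (f @^-1` E).
Proof.
elim: m X Y f E => [|m IH] X Y f E fc /=; first by move/continuousP: fc; apply.
move=> [F FS ->]; exists ((fun z => (f z.1, z.2)) @^-1` F).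
  apply: (IH _ _ _ (~` F)) => //; apply: continuous_pair.
    by move=> z; apply: continuous_comp; [exact: cvg_fst | exact: fc].
  by move=> z; exact: cvg_snd.
apply/seteqP; split => [z [[z' y] /= Fz zE]|z [[z' y] /= Fz <-]].
  by exists (z, y) => //=; rewrite -zE.
by exists (f z', y).
Qed.

Lemma continuous_baire_coord i : continuous (fun y : baire_space => y i).
Proof. exact: (@continuous_coord nat (fun=> nat)). Qed.

Lemma continuous_snd_coord (X : topologicalType) i :
  continuous (fun z : X * baire_space => z.2 i).
Proof.
move=> z; apply: (@continuous_comp _ _ _ snd (fun y : baire_space => y i)).
  exact: cvg_snd.
exact: continuous_baire_coord.
Qed.

Lemma Sigma11_trivial m (X : topologicalType) (P : Prop) :
  Sigma11 m [set _ : X | P].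
Proof.
elim: m X P => [|m IH] X P /=.
  have [p|p] := pselect P.
    by rewrite (_ : [set _ | _] = setT) ?predeqE//; exact: openT.
  by rewrite (_ : [set _ | _] = set0) ?predeqE//; exact: open0.
exists [set _ | P]; first exact: (IH _ (~ P)).
by apply/seteqP; split => [z p|z [[z' y] /= p _]//]; exists (z, fun=> 0).
Qed.

(** Above the open level, coordinate 0 of the Baire point names the index [k] and the other
    coordinates are the witness for [E k]. *)
Lemma Sigma11_bigcup m (X : topologicalType) (E : nat -> set X) :
  (forall i, Sigma11 m (E i)) -> Sigma11 m (\bigcup_i E i).
Proof.
case: m => [|m] ES; first by apply: bigcup_open => i _; exact: ES.
have [K KP] := choice (fun k => (let: ex_intro2 F FS EF := ES k in
  ex_intro (fun F => Sigma11 m (~` F) /\ E k = fst @` F) F (conj FS EF))).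
exists [set z : X * baire_space |
    K (z.2 0) (z.1, (fun i => z.2 i.+1) : baire_space)].
  apply: (Sigma11_glue (c := fun z : X * baire_space => z.2 0)
    (E := fun k => (fun z : X * baire_space =>
      (z.1, (fun i => z.2 i.+1) : baire_space)) @^-1` (~` K k))) => k.
    by apply: open_preimage_discrete; exact: continuous_snd_coord.
  apply: Sigma11_preimage; last by case: (KP k).
  apply: continuous_pair; first by move=> z; exact: cvg_fst.
  apply: continuous_prod => i; exact: continuous_snd_coord.
apply/seteqP; split => [z [k _]|z [[z' y] /= Kz <-]].
  have [_ ->] := KP k => -[[z' y] /= Kz <-].
  by exists (z', (fun i => if i is j.+1 then y j else k) : baire_space).
have [_ EK] := KP (y 0); exists (y 0) => //=; rewrite EK.
by exists (z', (fun i => y i.+1) : baire_space).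
Qed.

(* Row [i] of [u] has its first [true] at position [x i] and is arbitrary after
   it, so that the invalid codes are those with an all-[false] row. *)
Definition codes (u : cantor_space) (x : baire_space) : Prop :=
  forall i j : nat, j <= x i -> u (pickle (i, j)) = (j == x i).

Lemma codes_inj u x x' : codes u x -> codes u x' -> x = x'.
Proof.
move=> ux ux'; apply/funext => i.
wlog xx' : x x' ux ux' / x i <= x' i.
  move=> W; case/orP: (leq_total (x i) (x' i)) => /W; first exact.
  by move=> W'; apply/esym/W'.
by have := ux' i _ xx'; rewrite ux// eqxx => /esym/eqP.
Qed.

Lemma codes_ex (x : baire_space) : exists u, codes u x.
Proof.
exists (fun k => if unpickle k is Some ij then ij.2 == x ij.1 else false).
by move=> i j _; rewrite pickleK.
Qed.

Lemma codesPn (u : cantor_space) :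
  ~ (exists x, codes u x) -> exists i : nat, forall j : nat, ~~ u (pickle (i, j)).
Proof.
apply: contra_notP => /forallNP h.
have {h}h (i : nat) : exists j : nat, u (pickle (i, j)).
  by have /existsNP[j /negP] := h i; rewrite negbK; exists j.
exists (fun i => ex_minn (h i)) => i j; case: ex_minnP => n un nP.
rewrite leq_eqVlt => /orP[/eqP ->|jn]; first by rewrite eqxx.
by rewrite (ltn_eqF jn); apply/negP => /nP; rewrite leqNgt jn.
Qed.

(** A code determines the point it codes. Hence a pair [(z, u)] is outside the set [C] below exactly
    when [u] codes nothing or codes some [x] with [(z, x)] outside [F], which is again an
    existential condition. *)
Lemma cantor_uniformization m (X : topologicalType) (F : set (X * baire_space)) :
  Sigma11 m.+1 (~` F) ->
  exists2 C : set (X * cantor_space), Pi11 m.+1 C & fst @` C = fst @` F.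
Proof.
move=> [H HS FH].
(* Coordinate 0 of [y] selects a case of [H'], the odd coordinates carry [x], and the positive even
   ones carry the witness that [(z, x)] is outside [F]. *)
pose xp (y : baire_space) : baire_space := fun i => y i.*2.+1.
pose wp (y : baire_space) : baire_space := fun i => y i.*2.+2.
pose C := [set z : X * cantor_space | exists x, codes z.2 x /\ F (z.1, x)].
pose H' k : set ((X * cantor_space) * baire_space) := if k is i.+1
  then [set z | forall j : nat, ~~ z.1.2 (pickle (i, j))]
  else [set z | codes z.1.2 (xp z.2) /\ H ((z.1.1, xp z.2), wp z.2)].
exists C; last first.
  apply/seteqP; split => [z [[z' u] /= [x [_ Fx]] <-]|z [[z' x] /= Fx <-]].
    by exists (z', x).
  by have [u ux] := codes_ex x; exists (z', u) => //; exists x.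
have c11 : continuous (fun z : (X * cantor_space) * baire_space => z.1.1).
  by move=> z; apply: continuous_comp; exact: cvg_fst.
have c12 k : continuous (fun z : (X * cantor_space) * baire_space => z.1.2 k).
  move=> z; apply: (@continuous_comp _ _ _ (fun z => z.1.2)
    (fun u : cantor_space => u k)).
    by apply: continuous_comp; [exact: cvg_fst | exact: cvg_snd].
  exact: (@continuous_coord nat (fun=> bool)).
have c2 k : continuous (fun z : (X * cantor_space) * baire_space => z.2 k).
  exact: continuous_snd_coord.
exists [set z | H' (z.2 0) z].
  apply: (Sigma11_glue (c := fun z : (X * cantor_space) * baire_space => z.2 0)
    (E := fun k => ~` H' k)) => [k|[|i]]; first exact: open_preimage_discrete.
    (* Index 0 stands for the failure of [H], index [k'.+1] for a failure of the coding at the cell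
       [(i, j)] numbered [k']. Numbers of no cell repeat the failure of [H]. *)
    rewrite [X in Sigma11 _ X](_ : _ = \bigcup_k (if obind unpickle
        (if k is k'.+1 then Some k' else None) is Some ij
      then [set z | ij.2 <= xp z.2 ij.1 /\
        z.1.2 (pickle ij) <> (ij.2 == xp z.2 ij.1)]
      else (fun z => ((z.1.1, xp z.2), wp z.2)) @^-1` (~` H))).
      apply: Sigma11_bigcup => k; case: obind => [[i j]|] /=.
        apply: (Sigma11_glue
          (c := fun z : (X * cantor_space) * baire_space => xp z.2 i)
          (E := fun n => [set z : (X * cantor_space) * baire_space |
            j <= n /\ z.1.2 (pickle (i, j)) <> (j == n)])) => n.
          by apply: open_preimage_discrete; exact: c2.
        apply: (Sigma11_glue (c := fun z : (X * cantor_space) * baire_space =>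
            z.1.2 (pickle (i, j)))
          (E := fun b => [set z | j <= n /\ b <> (j == n)])) => b.
          by apply: open_preimage_discrete; exact: c12.
        exact: Sigma11_trivial.
      apply: Sigma11_preimage HS.
      apply: continuous_pair; first apply: continuous_pair => //.
        by apply: continuous_prod => i; exact: c2.
      by apply: continuous_prod => i; exact: c2.
    apply/seteqP; split => z /=.
      move=> /not_andP[|nH].
        move=> /existsNP[i] /existsNP[j] /not_implyP[ij] ne.
        by exists (pickle (i, j)).+1 => //=; rewrite pickleK.
      by exists 0.
    move=> [k _]; case: obind => [[i j] /= [ij ne] [cd _]|/= nH [_ //]].
    by apply: ne; exact: cd.
  have -> : ~` H' i.+1 = \bigcup_(j in [set: nat])
      [set z : (X * cantor_space) * baire_space | z.1.2 (pickle (i, j))].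
    apply/seteqP; split => z /=.
      by move=> /existsNP[j /negP]; rewrite negbK; exists j.
    by move=> [j _ uj] /(_ j); rewrite uj.
  apply: Sigma11_bigcup => j.
  apply: (Sigma11_glue (c := fun z : (X * cantor_space) * baire_space =>
      z.1.2 (pickle (i, j)))
    (E := fun b : bool => [set z : (X * cantor_space) * baire_space | b])) => b.
      by apply: open_preimage_discrete; exact: c12.
  exact: Sigma11_trivial.
apply/seteqP; split => [[z u] /= nC|[z u] [[[z' u'] y] /=]].
  have [[x ux]|/codesPn[i iP]] := pselect (exists x, codes u x); last first.
    by exists ((z, u), fun=> i.+1).
  have : (~` F) (z, x) by move=> Fx; apply: nC; exists x.
  rewrite FH => -[[zx w] /= Hw zE].
  exists ((z, u), (fun k => if k is j.+1 then
     (if odd j then w j./2 else x j./2) else 0) : baire_space) => //=.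
  set y := (X in codes _ (xp X)).
  have -> : xp y = x by apply/funext => k; rewrite /xp /y /= odd_double doubleK.
  have -> : wp y = w.
    by apply/funext => k; rewrite /wp /y /= odd_double uphalf_double.
  by rewrite -zE.
move=> + [<- <-] [x /= [ux Fx]].
case: (y 0) => [/= [uy Hy]|i /= /(_ (x i))]; last by rewrite ux// eqxx.
have : (~` F) (z', xp y) by rewrite FH; exists ((z', xp y), wp y).
by rewrite (codes_inj uy ux).
Qed.

(** * Strategies *)

Section Machines.
Variable S : approx_space.
Implicit Types (A B C : carrier S) (a b : approx S) (X : set (carrier S)).

Definition shift (M N : Type) (sigma : seq M -> N) (m : M) : seq M -> N :=
  fun h => sigma (m :: h).

Definition moveII a A (m : approx S * carrier S) : Prop :=
  extensions (lh a).+1 a A m.1 /\ basic m.1 A m.2.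

Lemma mkseq_cons (M : Type) (m : M) (x : nat -> M) n :
  mkseq (fun k => if k is j.+1 then x j else m) n.+1 = m :: mkseq x n.
Proof. by rewrite /mkseq /= -[1]/(1 + 0) iotaDl -map_comp. Qed.

Lemma strategyI_first a A sigma X :
  strategyI_ensures a A sigma X -> basic a A (sigma [::]).
Proof.
move=> ens; have [/(_ 0) + _] := ens (fun=> (a, A)).
by apply => i; rewrite ltn0.
Qed.

Lemma strategyI_shift a A sigma X m :
  strategyI_ensures a A sigma X -> moveII a (sigma [::]) m ->
  strategyI_ensures m.1 m.2 (shift sigma m) X.
Proof.
move=> ens mm x y; pose x' k := if k is j.+1 then x j else m.
have yE n : y n = sigma (mkseq x' n.+1) by rewrite /y mkseq_cons.
have lhm : lh m.1 = (lh a).+1 by case: mm => -[].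
have stE n : stem a x' n.+1 = stem m.1 x n by case: n.
have sdE n : side A x' n.+1 = side m.2 x n by case: n.
have lE n : legalII a x' (fun n => sigma (mkseq x' n)) n.+1 = legalII m.1 x y n.
  by rewrite /legalII stE yE.
have [l o] := ens x'; split.
  move=> n ln; have := l n.+1; rewrite /legalI stE sdE yE; apply.
  by case=> [_|i]; [exact: mm | rewrite lE ltnS; exact: ln].
move=> ln; have [|B oB XB] := o; first by case=> [|n]; [exact: mm | rewrite lE].
by exists B => // n; rewrite lhm -stE -oB addnS addSn.
Qed.

(** [s n] is what remains of [s 0] after [n] rounds, so [s n [::]] is the reply of [s 0] to the
    first [n] moves of II. *)
Lemma strategyI_thread a A (s : nat -> seq (approx S * carrier S) -> carrier S)
    X (x : nat -> approx S * carrier S) :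
  strategyI_ensures a A (s 0) X ->
  (forall n, s n.+1 = shift (s n) (x n)) ->
  (forall n, moveII (stem a x n) (s n [::]) (x n)) ->
  exists2 B, outcome a x B & X B.
Proof.
move=> ens sS mx; have [_ ] := ens x; apply => n.
rewrite /legalII.
suff -> : s 0 (mkseq x n) = s n [::] by exact: mx.
have : forall k, s k (mkseq (fun i => x (k + i)) n) = s (k + n) [::].
  elim: n => [|n IH] k; first by rewrite addn0.
  rewrite addnS -addSn -IH sS /shift; congr (s k _).
  rewrite -[RHS]mkseq_cons; apply: eq_mkseq => -[|i]; first by rewrite addn0.
  by rewrite addnS addSn.
by move=> /(_ 0).
Qed.

Lemma foldl_mkseqS (M Q : Type) (f : Q -> M -> Q) (q : Q) (x : nat -> M) n :
  foldl f q (mkseq x n.+1) = f (foldl f q (mkseq x n)) (x n).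
Proof. by rewrite mkseqS -cats1 foldl_cat. Qed.

(** Strategies are built as state machines: [good] is the invariant and [next] records how a state
    arose from the previous one. Choice turns the step into a function, which is folded over the
    moves of II; the payoff is checked on the whole sequence of states. *)
Lemma strategyI_of_machine (Q : Type) (stm : Q -> approx S) (mv : Q -> carrier S)
    (good : Q -> Prop) (next : Q -> approx S * carrier S -> Q -> Prop)
    (q0 : Q) A X :
  good q0 -> basic (stm q0) A (mv q0) ->
  (forall q m, good q -> moveII (stm q) (mv q) m ->
    exists q', [/\ good q', next q m q', stm q' = m.1 & basic m.1 m.2 (mv q')]) ->
  (forall x (q : nat -> Q), q 0 = q0 -> (forall n, good (q n)) ->
     (forall n, stm (q n) = stem (stm q0) x n) ->
     (forall n, moveII (stm (q n)) (mv (q n)) (x n)) ->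
     (forall n, next (q n) (x n) (q n.+1)) ->
     exists2 B, outcome (stm q0) x B & X B) ->
  exists sigma, strategyI_ensures (stm q0) A sigma X.
Proof.
move=> g0 b0 step payoff.
(* Legality is a premise inside the chosen property, so at illegal positions any state will do. *)
have /choice[f fP] (qm : Q * (approx S * carrier S)) : exists q',
    good qm.1 -> moveII (stm qm.1) (mv qm.1) qm.2 ->
    [/\ good q', next qm.1 qm.2 q', stm q' = qm.2.1 &
       basic qm.2.1 qm.2.2 (mv q')].
  case: qm => q m /=.
  have [h|h] := pselect (good q /\ moveII (stm q) (mv q) m).
    by case: h => gq mq; have [q' ?] := step _ _ gq mq; exists q'.
  by exists q => gq mq; case: h.
pose F q m := f (q, m).
exists (fun h => mv (foldl F q0 h)) => x y.
pose q n := foldl F q0 (mkseq x n).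
have qS n : q n.+1 = F (q n) (x n) by exact: foldl_mkseqS.
have inv n : (forall i, i < n -> legalII (stm q0) x y i) ->
    [/\ good (q n), stm (q n) = stem (stm q0) x n &
       legalI (stm q0) A x y n].
  elim: n => [|n IH] ln; first by split.
  have [gn sn _] : [/\ good (q n), stm (q n) = stem (stm q0) x n &
       legalI (stm q0) A x y n] by apply: IH => i /ltnW; exact: ln.
  have mn : moveII (stm (q n)) (mv (q n)) (x n) by rewrite sn; exact: ln.
  by have [] := fP (q n, x n) gn mn; rewrite -[f _]/(F _ _) -qS.
split=> [n ln|ln]; first by have [] := inv n ln.
have {}inv n := inv n (fun i _ => ln i).
have mn n : moveII (stm (q n)) (mv (q n)) (x n).
  by have [_ -> _] := inv n; exact: ln.
apply: (payoff x q) => // n; try by case: (inv n).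
by have [gn _ _] := inv n; have [] := fP (q n, x n) gn (mn n); rewrite qS.
Qed.

Lemma strategyII_of_machine (Q : Type) (stm : Q -> approx S) (sd : Q -> carrier S)
    (good : Q -> Prop) (next : Q -> carrier S -> Q -> Prop) (q0 : Q) X :
  good q0 ->
  (forall q A, good q -> basic (stm q) (sd q) A ->
    exists q', [/\ good q', next q A q' & moveII (stm q) A (stm q', sd q')]) ->
  (forall q : nat -> Q, q 0 = q0 -> (forall n, good (q n)) ->
     (exists y, forall n, next (q n) (y n) (q n.+1) /\
       moveII (stm (q n)) (y n) (stm (q n.+1), sd (q n.+1))) ->
     exists2 B,
       outcome (stm q0) (fun n => (stm (q n.+1), sd (q n.+1))) B & X B) ->
  exists tau, strategyII_ensures (stm q0) (sd q0) tau X.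
Proof.
move=> g0 step payoff.
have /choice[f fP] (qm : Q * carrier S) : exists q',
    good qm.1 -> basic (stm qm.1) (sd qm.1) qm.2 ->
    [/\ good q', next qm.1 qm.2 q' &
      moveII (stm qm.1) qm.2 (stm q', sd q')].
  case: qm => q A /=.
  have [h|h] := pselect (good q /\ basic (stm q) (sd q) A).
    by case: h => gq mq; have [q' ?] := step _ _ gq mq; exists q'.
  by exists q => gq mq; case: h.
pose F q A := f (q, A).
exists (fun h => (stm (foldl F q0 h), sd (foldl F q0 h))) => y x.
pose q n := foldl F q0 (mkseq y n).
have qS n : q n.+1 = F (q n) (y n) by exact: foldl_mkseqS.
have sE n : stem (stm q0) x n = stm (q n) by case: n.
have dE n : side (sd q0) x n = sd (q n) by case: n.
have inv n : (forall i, i < n -> legalI (stm q0) (sd q0) x y i) -> good (q n).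
  elim: n => [//|n IH] ln.
  have gn : good (q n) by apply: IH => i /ltnW; exact: ln.
  have := ln n (ltnSn n); rewrite /legalI sE dE => bn.
  by have [] := fP (q n, y n) gn bn; rewrite -[f _]/(F _ _) -qS.
have stp n : (forall i, i <= n -> legalI (stm q0) (sd q0) x y i) ->
    next (q n) (y n) (q n.+1) /\
    moveII (stm (q n)) (y n) (stm (q n.+1), sd (q n.+1)).
  move=> ln; have gn : good (q n) by apply: inv => i /ltnW; exact: ln.
  have := ln n (leqnn n); rewrite /legalI sE dE => bn.
  by have [_] := fP (q n, y n) gn bn; rewrite -[f _]/(F _ _) -qS.
split=> [n ln|ln]; first by rewrite /legalII sE; have [] := stp n ln.
apply: (payoff q) => // [n|]; first exact: inv.
by exists y => n; apply: stp.
Qed.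


(** The outcome depends on the stems alone. So the sets [C] fed to the strategy may differ from
    those that II plays in the actual run. *)
Lemma strategyI_follow A (b : nat -> approx S)
    (s : nat -> seq (approx S * carrier S) -> carrier S) X :
  strategyI_ensures (b 0) A (s 0) X ->
  (forall n, exists C, moveII (b n) (s n [::]) (b n.+1, C) /\
     s n.+1 = shift (s n) (b n.+1, C)) ->
  exists2 B, (forall n, r B (lh (b 0) + n) = b n) & X B.
Proof.
move=> ens /choice[C CP].
have stE n : stem (b 0) (fun n => (b n.+1, C n)) n = b n by case: n.
have [|n|B oB XB] := strategyI_thread (x := fun n => (b n.+1, C n)) ens.
- by move=> n; case: (CP n).
- by rewrite stE; case: (CP n).
by exists B => // n; rewrite oB stE.
Qed.

End Machines.

(** * Lengths, basic sets, and limits of chains of approximations *)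

Section Basics.
Variables (S : approx_space) (hS : wA2_space S).
Implicit Types (A B C : carrier S) (a b : approx S) (X : set (carrier S)).

Lemma lh_r A n : lh (r A n) = n.
Proof.
rewrite /lh; apply: xget_unique => /=.
  by exists A.
by move=> m [B _ /(A1_3 hS)[]].
Qed.

Lemma r_lh a : exists A, r A (lh a) = a.
Proof. by have [n [A _ <-]] := AR_union hS a; exists A; rewrite lh_r. Qed.

Lemma r_agree A B n k : r A n = r B n -> k <= n -> r A k = r B k.
Proof.
move=> AB; have [_ E] := A1_3 hS AB.
by rewrite leq_eqVlt => /predU1P[->//|/E].
Qed.

Lemma r_inj A B l : (forall n, r A (l + n) = r B (l + n)) -> A = B.
Proof.
move=> AB; apply: contrapT => /(A1_2 hS)[n]; apply.
exact: r_agree (AB n) (leq_addl _ _).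
Qed.

Lemma basicP a A B : basic a A B <-> leR B A /\ r B (lh a) = a.
Proof.
split=> [[le [n <-]]|[le rB]]; first by rewrite lh_r.
by split=> //; exists (lh a).
Qed.

Lemma basic_self a A B : basic a A B -> basic a B B.
Proof. by move=> [_ ?]; split=> //; exact: leR_refl. Qed.

Lemma basic_trans a A B C : leR B A -> basic a B C -> basic a A C.
Proof. by move=> AB [BC ?]; split=> //; exact: leR_trans BC AB. Qed.

(** This lets one move of I serve several strategies: an answer to the smaller set actually played
    is also an answer to the larger set that a strategy prescribes. *)
Lemma moveII_mono a A A' m C :
  leR A' A -> moveII a A' m -> basic m.1 m.2 C -> moveII a A (m.1, C).
Proof.
move=> le [[[n bn] ini lhm] b2] bC; split=> /=; last first.
  by apply: basic_trans bC => //; apply: leR_trans le; case: b2.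
split=> //; have [m' le'] := (wA2_2 hS _ _).1 le n.
by exists m'; exact: lefin_trans bn le'.
Qed.

Lemma moveII_lh a A m : moveII a A m -> lh m.1 = (lh a).+1.
Proof. by case=> -[]. Qed.

Lemma initial_r a b A : initial a b -> r A (lh b) = b -> r A (lh a) = a.
Proof.
move=> [B [m [n [mn -> ->]]]]; rewrite !lh_r => /r_agree; exact.
Qed.

(** Each [b n] is realised by some [W n]. The sequences of approximations of the [W n] converge, and
    the closedness of the space supplies an element realising the limit. *)
Lemma chain_outcome (b : nat -> approx S) :
  (forall n, initial (b n) (b n.+1)) -> (forall n, lh (b n.+1) = (lh (b n)).+1) ->
  exists B, forall n, r B (lh (b 0) + n) = b n.
Proof.
move=> ini lhS.
have lhE n : lh (b n) = lh (b 0) + n.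
  by elim: n => [|n IH]; rewrite ?addn0// lhS IH addnS.
have [W WP] := choice (fun n => r_lh (b n)).
have WS n : r (W n.+1) (lh (b n)) = b n by exact: initial_r (ini n) (WP _).
have Wle n k : r (W (n + k)) (lh (b n)) = b n.
  elim: k => [|k IH]; first by rewrite addn0.
  rewrite -{2}IH; apply: (@r_agree _ _ (lh (b (n + k)))).
    by rewrite addnS WS WP.
  by rewrite (lhE n) (lhE (n + k)) leq_add2l leq_addr.
have Wst n k : r (W (n + k)) n = r (W n) n.
  apply: (@r_agree _ _ (lh (b n))); first by rewrite Wle WP.
  by rewrite lhE leq_addl.
(* The diagonal is the limit: [lh (b n)] is at least [n], so level [n] no longer changes from [W n]
   on. *)
pose g : {ptws nat -> discrete_topology (approx S)} := fun n => r (W n) n.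
have [B _ Bg] : range (@r S : _ -> {ptws nat -> discrete_topology (approx S)}) g.
  have gc : (fun N => (r (W N) : {ptws nat -> discrete_topology (approx S)}))
      @ \oo --> g.
    apply: cvg_prod_stable => N i iN.
    by rewrite /g -(subnKC (ltnW iN)) Wst.
  by apply: (closed_cvg _ (wA2_closed hS) _ _ gc); near=> N; exists (W N).
exists B => n; rewrite -lhE -[RHS](Wle n (lh (b 0))).
have := congr1 (fun h => h (lh (b n))) Bg; rewrite /g => ->.
by rewrite {1}lhE addnC.
Unshelve. all: by end_near. Qed.

Lemma legal_outcome a x (y : nat -> carrier S) :
  (forall n, moveII (stem a x n) (y n) (x n)) -> exists B, outcome a x B.
Proof.
move=> mx; apply: (chain_outcome (b := stem a x)) => n.
  by case: (mx n) => -[].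
exact: moveII_lh (mx n).
Qed.

(** Each [P t] survives further refinement, so finitely many of them can be secured one after
    another. *)
Lemma common_refinement (T : eqType) a B (L : seq T)
    (P : T -> carrier S -> Prop) :
  basic a B B ->
  (forall t C C', P t C -> basic a C C' -> P t C') ->
  (forall t C, t \in L -> basic a B C -> exists2 C', basic a C C' & P t C') ->
  exists2 C, basic a B C & forall t, t \in L -> P t C.
Proof.
move=> BB Pm; elim: L => [|t L IH] PL; first by exists B.
have [|C BC CP] := IH; first by move=> t' C tL; apply: PL; rewrite inE tL orbT.
have [C' CC' PC'] := PL t C (mem_head _ _) BC.
exists C'; first exact: basic_trans (BC.1) CC'.
move=> t'; rewrite inE => /predU1P[->//|/CP PC]; exact: Pm PC CC'.
Qed.

End Basics.

(** * Analytic sets *)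

Section Union.
Variables (S : approx_space) (hS : wA2_space S).
Implicit Types (A B C : carrier S) (a b : approx S) (X : set (carrier S)).

Definition Iwins a A X : Prop := exists sigma, strategyI_ensures a A sigma (~` X).

Definition bad a A X : Prop := forall A', basic a A A' -> ~ Iwins a A' X.

(** [A] is the set reached by I in the actual game. It need only lie below the set that [sigma]
    prescribes. *)
Definition follows a A X (sigma : seq (approx S * carrier S) -> carrier S) :
    Prop :=
  basic a A A /\
  exists2 B, strategyI_ensures a B sigma (~` X) & leR A (sigma [::]).

Lemma follows_mono a A A' X sigma :
  basic a A A' -> follows a A X sigma -> follows a A' X sigma.
Proof.
move=> AA' [_ [B ens le]]; split; first exact: (basic_self hS AA').
by exists B => //; apply: (leR_trans hS AA'.1 le).
Qed.

Lemma Iwins_follows a A X :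
  Iwins a A X -> exists2 A', basic a A A' & exists sigma, follows a A' X sigma.
Proof.
move=> [sigma ens]; have b0 := strategyI_first ens.
exists (sigma [::]) => //; exists sigma; split; first exact: (basic_self hS b0).
by exists A => //; exact: leR_refl.
Qed.

(** The stem comes from the actual answer [m] of II, whereas [C] is the set to which I has refined
    [m.2] before consulting [sigma]. *)
Lemma follows_step a A X sigma m C :
  follows a A X sigma -> moveII a A m -> basic m.1 m.2 C ->
  moveII a (sigma [::]) (m.1, C) /\
  exists2 C', basic m.1 C C' & follows m.1 C' X (shift sigma (m.1, C)).
Proof.
move=> [_ [B ens le]] mm mC.
have mC' : moveII a (sigma [::]) (m.1, C) by exact: moveII_mono mm mC.
have ens' := strategyI_shift ens mC'; have b0 := strategyI_first ens'.
split=> //; exists (shift sigma (m.1, C) [::]) => //.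
split; first exact: (basic_self hS b0).
by exists C => //; exact: leR_refl.
Qed.

Variable X : nat -> set (carrier S).

Definition reach_step (R : approx S -> carrier S -> Prop) a A : Prop :=
  exists m, moveII a A m /\ ((exists k, bad m.1 m.2 (X k)) \/ R m.1 m.2).

(** The least fixed point, written as the intersection of all relations closed under the step: II
    can force a bad position in finitely many rounds, and at least one. *)
Definition reach a B : Prop := forall R : approx S -> carrier S -> Prop,
  (forall a B, (forall A, basic a B A -> reach_step R a A) -> R a B) -> R a B.

Lemma reach_fold a B :
  (forall A, basic a B A -> reach_step reach a A) -> reach a B.
Proof.
move=> h R Rc; apply: (Rc a B) => A /h[m [mm bm]]; exists m; split=> //.
by case: bm => [|rm]; [left | right; exact: (rm R Rc)].
Qed.

Definition avoids a A : Prop := forall m, moveII a A m ->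
  (forall k, ~ bad m.1 m.2 (X k)) /\ ~ reach m.1 m.2.

Lemma not_reach_avoids a B : ~ reach a B -> exists2 A, basic a B A & avoids a A.
Proof.
move=> nr; apply: contrapT => h; apply: nr; apply: reach_fold => A BA.
apply: contrapT => ns; apply: h; exists A => // m mm.
by split=> [k bk|rm]; apply: ns; exists m; split=> //; [left; exists k|right].
Qed.

(** An outcome in the union would lie in some [X k], but from round [k.+1] on I follows a strategy
    against [X k]. *)
Lemma not_reach_Iwins a B : ~ reach a B -> Iwins a B (\bigcup_k X k).
Proof.
move=> /not_reach_avoids[A0 BA0 av0].
(* A state holds the stem, the move of I, the number of strategies being followed, and the
   strategies; only indices below that number are meaningful. *)
pose Q := ((approx S * carrier S) *
  (nat * (nat -> seq (approx S * carrier S) -> carrier S)))%type.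
pose stm (q : Q) := q.1.1; pose mv (q : Q) := q.1.2.
pose good (q : Q) := avoids (stm q) (mv q) /\
  forall k, k < q.2.1 -> follows (stm q) (mv q) (X k) (q.2.2 k).
pose next (q : Q) (m : approx S * carrier S) (q' : Q) :=
  q'.2.1 = q.2.1.+1 /\ forall k, k < q.2.1 -> exists C,
    moveII (stm q) (q.2.2 k [::]) (m.1, C) /\
    q'.2.2 k = shift (q.2.2 k) (m.1, C).
pose q0 : Q := ((a, A0), (0, fun _ _ => A0)).
apply: (@strategyI_of_machine _ Q stm mv good next q0) => //.
  move=> q m [av fol] mm.
  pose P k A' := exists sigma, follows m.1 A' (X k) sigma /\
    (k < q.2.1 -> exists C, moveII (stm q) (q.2.2 k [::]) (m.1, C) /\
       sigma = shift (q.2.2 k) (m.1, C)).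
  have mav C : basic m.1 m.2 C ->
      (forall k, ~ bad m.1 C (X k)) /\ ~ reach m.1 C.
    move=> mC; apply: (av (m.1, C)).
    exact: (moveII_mono hS (leR_refl hS _) mm mC).
  have Pm k C C' : P k C -> basic m.1 C C' -> P k C'.
    move=> [sigma [f l]] CC'; exists sigma; split=> //; exact: follows_mono f.
  have m2 : basic m.1 m.2 m.2 by case: mm => _ /(basic_self hS).
  (* The strategies with index below [q.2.1] are continued and the one with index [q.2.1] is
     started, which is possible because the position is not bad. *)
  have [k C _ mC|C mC CP] := common_refinement hS (L := iota 0 q.2.1.+1) m2 Pm.
    have [kn|kn] := ltnP k q.2.1.
      have [mC' [C' CC' f']] := follows_step (fol k kn) mm mC.
      by exists C' => //; eexists; split; [exact: f' | exists C].
    have [/(_ k) nb _] := mav C mC.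
    have /existsNP[C' /not_implyP[CC' /contrapT]] := nb.
    move=> /Iwins_follows[C'' CC'' [sigma f]].
    exists C''; first exact: (basic_trans hS CC'.1 CC'').
    by exists sigma; split=> //; rewrite ltnNge kn.
  (* A last refinement restores the avoidance of bad and reachable positions, and the strategies can
     still be followed below it. *)
  have [_ /not_reach_avoids[A' CA' av']] := mav C mC.
  have /choice[f' f'P] k : exists sigma, k < q.2.1.+1 ->
      follows m.1 A' (X k) sigma /\
    (k < q.2.1 -> exists C, moveII (stm q) (q.2.2 k [::]) (m.1, C) /\
       sigma = shift (q.2.2 k) (m.1, C)).
    have [kn|kn] := ltnP k q.2.1.+1; last by exists (q.2.2 k).
    have [|sigma sP] := Pm k C A' _ CA'; last by exists sigma.
    by apply: CP; rewrite mem_iota.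
  exists ((m.1, A'), (q.2.1.+1, f')); split=> //.
  - by split=> // k /f'P[].
  - by split=> // k kn; have [_] := f'P k (ltnW kn); exact.
  - exact: (basic_trans hS mC.1 CA').
move=> x q q00 gq sq mq nq.
have [B' oB] : exists B', outcome (stm q0) x B'.
  by apply: (legal_outcome hS (y := fun n => mv (q n))) => n; rewrite -sq.
exists B' => // -[k _ XB].
have nE n : (q n).2.1 = n.
  by elim: n => [|n IH]; [rewrite q00 | case: (nq n) => ->; rewrite IH].
have lhE n : lh (stm (q n)) = lh a + n.
  elim: n => [|n IH]; first by rewrite q00 addn0.
  by rewrite addnS -IH sq /= (moveII_lh (mq n)).
have [_ fol] := gq k.+1; have [|_ [B0 ens _]] := fol k; first by rewrite nE.
have [| |B'' oB'' XB''] := strategyI_follow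
  (b := fun n => stm (q (k.+1 + n))) (s := fun n => (q (k.+1 + n)).2.2 k)
  (X := ~` X k) (A := B0).
- by rewrite addn0.
- move=> n; have [_ /(_ k)] := nq (k.+1 + n).
  rewrite nE addSn ltnS leq_addr => /(_ isT)[C [mC sC]]; exists C.
  by rewrite addnS; have := sq (k + n).+2 => /= ->.
(* The simulated run and the actual one share their stems from round [k.+1] on, which determines the
   outcome. *)
apply: XB''; suff -> : B'' = B' by [].
apply: (r_inj hS (l := lh (stm (q k.+1)))) => n.
have := oB'' n; rewrite addn0 => ->.
by rewrite sq -oB lhE addnA.
Qed.

End Union.

(* A plan for II to reach a bad position; being well-founded it turns the least
   fixed point [reach] into a strategy that makes progress. *)
Inductive tree (M N : Type) := leaf of nat | node of (M -> N) & (M -> tree M N).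

(** * Sections of a closed set, and a strategy of II from a bad position *)

Section Analytic.
Variables (S : approx_space) (hS : wA2_space S).
Implicit Types (A B C : carrier S) (a b : approx S).

(** I opens with [B] and then repeats the last set of II: every outcome passes through [a], so it
    avoids [X]. *)
Lemma Iwins_disjoint a B (X : set (carrier S)) : basic a B B ->
  (forall A, r A (lh a) = a -> ~ X A) -> Iwins a B X.
Proof.
move=> BB nX.
apply: (@strategyI_of_machine _ (approx S * carrier S)%type fst snd
  (fun=> True) (fun _ _ _ => True) (a, B)) => //.
  by move=> q m _ [_ mb]; exists m; split=> //; exact: (basic_self hS mb).
move=> x q q0 _ sq mq _.
have [A oA] : exists A, outcome a x A.
  by apply: (legal_outcome hS (y := fun n => (q n).2)) => n; rewrite -sq.
by exists A => //; apply: nX; have := oA 0; rewrite addn0.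
Qed.

Local Notation tree := (tree (carrier S) (approx S * carrier S)).

Fixpoint wins_reach (X : nat -> set (carrier S)) (t : tree) a B : Prop :=
  match t with
  | leaf k => bad a B (X k)
  | node f g => forall A, basic a B A ->
      moveII a A (f A) /\ wins_reach X (g A) (f A).1 (f A).2
  end.

(** The plan is extracted by instantiating the least fixed point with the existence of a plan; it is
    a [node] because [reach] demands at least one round. *)
Lemma reach_wins X a B :
  reach X a B -> exists f g, wins_reach X (node f g) a B.
Proof.
move=> rch; apply: (rch (fun a B => exists f g, wins_reach X (node f g) a B)).
move=> {rch}a {}B h.
have /choice[f fP] A : exists mt : (approx S * carrier S) * tree, basic a B A ->
    moveII a A mt.1 /\ wins_reach X mt.2 mt.1.1 mt.1.2.
  have [/h[m [mm [[k bk]|[f [g w]]]]]|nA] := pselect (basic a B A).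
  - by exists (m, leaf _ _ k).
  - by exists (m, node f g).
  - by exists ((a, B), leaf _ _ 0) => /nA.
by exists (fun A => (f A).1), (fun A => (f A).2).
Qed.

Variable F : set (carrier S * baire_space).
Hypothesis cF : closed F.

Definition section_from (s : seq nat) : set (carrier S) :=
  [set A | exists x : baire_space, mkseq x (size s) = s /\ F (A, x)].

Lemma section_from_nil : section_from [::] = fst @` F.
Proof.
apply/seteqP; split => [A [x [_ Fx]]|A [[A' x] Fx <-]]; first by exists (A, x).
by exists x.
Qed.

Lemma bad_reach s a A : basic a A A -> bad a A (section_from s) ->
  reach (fun k => section_from (rcons s k)) a A.
Proof.
move=> AA bA; apply: contrapT => /(not_reach_Iwins hS) w; apply: (bA A AA).
move: w; congr Iwins; apply/seteqP; split => [B [k _ [x [+ Fx]]]|B [x [xs Fx]]].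
  by rewrite size_rcons mkseqS => /rcons_inj[xs _]; exists x.
by exists (x (size s)) => //; exists x; rewrite size_rcons mkseqS xs.
Qed.

Lemma bad_strategyII a A : basic a A A -> bad a A (fst @` F) ->
  exists tau, strategyII_ensures a A tau (fst @` F).
Proof.
rewrite -section_from_nil => AA bA.
have [f0 [g0 w0]] := reach_wins (bad_reach AA bA).
(* Besides the position, a state holds the finite sequence built so far and the current plan for
   extending it by one entry. *)
pose Q := ((approx S * carrier S) * (seq nat * tree))%type.
pose stm (q : Q) := q.1.1; pose sd (q : Q) := q.1.2.
pose good (q : Q) := exists f g, q.2.2 = node f g /\
  wins_reach (fun k => section_from (rcons q.2.1 k)) q.2.2 (stm q) (sd q).
pose hits (q q' : Q) := exists k, q'.2.1 = rcons q.2.1 k /\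
  bad (stm q') (sd q') (section_from q'.2.1).
pose next (q : Q) A (q' : Q) := hits q q' \/
  q'.2.1 = q.2.1 /\ (if q.2.2 is node f g then q'.2.2 = g A else False).
pose q0 : Q := ((a, A), ([::], node f0 g0)).
apply: (@strategyII_of_machine _ Q stm sd good next q0); first by exists f0, g0.
  move=> [[b B] [s t]] C [f [g [/= -> w]]] bC.
  have [mC wC] := w C bC.
  case gC: (g C) wC => [k|f' g'] wC.
    have [] := reach_wins (bad_reach (basic_self hS mC.2) wC).
    move=> f' [g' w'].
    exists ((f C), (rcons s k, node f' g')); split.
    - by exists f', g'.
    - by left; exists k.
    - by case: (f C) mC.
  exists ((f C), (s, node f' g')); split.
  - by exists f', g'.
  - by right; split=> //=; rewrite gC.
  - by case: (f C) mC.
move=> q q00 gq [y yP]; pose x n := (stm (q n.+1), sd (q n.+1)).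
have mq n : moveII (stm (q n)) (y n) (x n) by case: (yP n).
have sE n : stem (stm q0) x n = stm (q n) by case: n => //=; rewrite q00.
have [B oB] : exists B, outcome (stm q0) x B.
  by apply: (legal_outcome hS (y := y)) => n; rewrite sE.
exists B => //; rewrite section_from_nil.
pose s n := (q n).2.1.
(* By induction on the current plan: as long as nothing is hit, the play descends into a subtree. *)
have progress n : exists2 m, n <= m & s m = s n /\ hits (q m) (q m.+1).
  have : exists t, (q n).2.2 = t by eexists.
  case=> t; elim: t n => [k|f g IH] n tn.
    by have [f [g []]] := gq n; rewrite tn.
  have [[h|[ss nx]] _] := yP n; first by exists n.
  move: nx; rewrite tn => /IH[m nm [sm hm]]; exists m; first exact: ltnW.
  by rewrite sm.
have hit N : exists m, [/\ N <= m, N <= size (s m) &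
    bad (stm (q m)) (sd (q m)) (section_from (s m))].
  elim: N => [|N [m [Nm Ns _]]].
    by have [m _ [_ [k [_ bk]]]] := progress 0; exists m.+1.
  have [m' mm' [sm [k [sk bk]]]] := progress m; exists m'.+1; split=> //.
    exact: leq_trans Nm mm'.
  by rewrite /s sk size_rcons ltnS -/(s m') sm.
have sS n : prefix (s n) (s n.+1).
  have [[[k [sk _]]|[sk _]] _] := yP n; rewrite /s sk; last exact: prefix_refl.
  exact: prefix_rcons.
have sle n m : n <= m -> prefix (s n) (s m).
  elim: m => [|m IH]; first by rewrite leqn0 => /eqP ->; exact: prefix_refl.
  rewrite leq_eqVlt => /predU1P[->|]; first exact: prefix_refl.
  by rewrite ltnS => /IH nm; apply: prefix_trans nm (sS m).
have nthE n m i : i < size (s n) -> i < size (s m) ->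
    nth 0 (s n) i = nth 0 (s m) i.
  wlog nm : n m / n <= m.
    move=> W; case/orP: (leq_total n m) => /W; first exact.
    by move=> + ? ? => ->.
  by move=> ? ?; have /prefixP[u ->] := sle _ _ nm; rewrite nth_cat ifT.
have [M MP] := choice hit.
(* At [M i.+1] the sequence has more than [i] entries, so the default 0 is never read. *)
pose z : baire_space := fun i => nth 0 (s (M i.+1)) i.
have lhE n : lh (stm (q n)) = lh a + n.
  elim: n => [|n IH]; first by rewrite q00 addn0.
  by rewrite addnS -IH -(moveII_lh (mq n)).
(* [F] has points agreeing with [(B, z)] up to [N]: otherwise no element through the stem at [M N]
   would lie in the section, and I would win there by [Iwins_disjoint], against badness. *)
have /choice[u uP] N : exists u : carrier S * baire_space,
    [/\ F u, r u.1 N = r B N & forall i, i < N -> u.2 i = z i].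
  have [NM Ns bM] := MP N.
  have bs : basic (stm (q (M N))) (sd (q (M N))) (sd (q (M N))).
    case: (M N) => [|k]; first by rewrite q00.
    exact: (basic_self hS (mq k).2).
  have : ~ Iwins (stm (q (M N))) (sd (q (M N))) (section_from (s (M N))).
    exact: bM.
  apply: contra_notP => nu; apply: Iwins_disjoint => // A' rA' [x' [xs Fx]].
  apply: nu; exists (A', x'); split=> //= [|i iN].
    apply: (r_agree hS (n := lh (stm (q (M N))))).
      by rewrite rA' lhE -sE -oB.
    by rewrite lhE (leq_trans NM)// leq_addl.
  have iM : i < size (s (M N)) by exact: leq_trans iN Ns.
  rewrite /z (nthE _ (M N)) //; last by case: (MP i.+1).
  by rewrite -xs nth_mkseq.
exists (B, z) => //.
have uc : u @ \oo --> (B, z).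
  have c1 : (fun n => (u n).1) @ \oo --> B.
    by apply: (cvg_approx_stable hS) => // N; case: (uP N).
  have c2 : (fun n => (u n).2) @ \oo --> z.
    by apply: cvg_prod_stable => N i; case: (uP N) => _ _; exact.
  rewrite (_ : u = fun n => ((u n).1, (u n).2)); first exact: cvg_pair c1 c2.
  by apply/funext => n; case: (u n).
by apply: (closed_cvg _ cF _ _ uc); near=> N; case: (uP N).
Unshelve. all: by end_near. Qed.

End Analytic.

Section Analytic_Ramsey.
Variables (S : approx_space) (hS : wA2_space S).

Lemma AR_below_basic a (A : carrier S) : AR_below A a -> exists B, basic a A B.
Proof.
move=> [n an]; case dE: (depth A a) => [d|].
  by apply: (A3_1 hS dE); split; [exact: leR_refl | exists d].
by move: dE; rewrite /depth; case: pselect => // -[]; exists n; apply/asboolP.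
Qed.

Lemma analytic_Ramsey (E : set (carrier S)) : analytic E -> Kastanas_Ramsey E.
Proof.
move=> [F oF ->] A a /AR_below_basic[B AB].
have cF : closed F by rewrite -[F]setCK; exact: open_closedC.
have [[C BC w]|nw] := pselect (exists2 C, basic a B C & Iwins a C (fst @` F)).
  by exists C; [exact: (basic_trans hS AB.1 BC) | left].
exists B => //; right.
apply: bad_strategyII => //; first exact: (basic_self hS AB).
by move=> C BC w; apply: nw; exists C.
Qed.
End Analytic_Ramsey.

(** * Projections *)

Section Projection.
Variables (S : approx_space) (hS : wA2_space S).
Implicit Types (A B : carrier S) (a b : approx S).
Local Notation PS := (prod_space S).
Implicit Types (ap bq : approx PS) (Au Bv : carrier PS).

Lemma approx_inj ap bq : val ap = val bq -> ap = bq.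
Proof. exact: val_inj. Qed.

Lemma approx_eq ap bq :
  (val ap).1 = (val bq).1 -> (val ap).2 = (val bq).2 -> ap = bq.
Proof.
move=> e1 e2; apply: approx_inj; rewrite (surjective_pairing (val ap)) e1 e2.
exact: (esym (surjective_pairing (val bq))).
Qed.

Lemma lh_fst ap : lh (val ap).1 = size (val ap).2.
Proof.
by have [A _ <-] := set_mem (valP ap); rewrite (lh_r hS).
Qed.

Lemma prod_rE ap A : r A (lh (val ap).1) = (val ap).1 ->
  @r PS (A, nth false (val ap).2) (lh (val ap).1) = ap.
Proof.
by move=> rA; apply: approx_eq => //=; rewrite lh_fst mkseq_nth.
Qed.

Lemma prod_lh ap : lh ap = lh (val ap).1.
Proof.
rewrite {1}/lh; apply: xget_unique => /=.
  have [A rA] := r_lh hS (val ap).1.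
  by exists (A, nth false (val ap).2) => //; exact: prod_rE.
by move=> n [Au _ <-] /=; rewrite (lh_r hS).
Qed.

Lemma prod_r_inj l Au Bv :
  (forall n, @r PS Au (l + n) = @r PS Bv (l + n)) -> Au = Bv.
Proof.
case: Au Bv => [A u] [B v] AB.
have AB' n : (r A (l + n), mkseq u (l + n)) = (r B (l + n), mkseq v (l + n)).
  exact: (congr1 (fun ap : approx PS => val ap) (AB n)).
congr pair; first by apply: (r_inj hS (l := l)) => n; case: (AB' n).
apply/funext => i; have [_ /(congr1 (fun s => nth false s i))] := AB' i.+1.
by rewrite !nth_mkseq// addnS ltnS leq_addl.
Qed.

Lemma prod_leR Au Bv : leR Au Bv <-> leR Au.1 Bv.1.
Proof. by rewrite (wA2_2 hS). Qed.

Lemma prod_basic ap Au Bv : basic ap Au Bv -> basic (val ap).1 Au.1 Bv.1.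
Proof. by move=> [/prod_leR le [n <-]]; split=> //; exists n. Qed.

(** The finite bit sequence is padded with [false]; the order on the product compares first
    coordinates only, so any padding would be legal. *)
Lemma prod_basic_nth ap Au B : basic (val ap).1 Au.1 B ->
  basic ap Au (B, nth false (val ap).2).
Proof.
move=> /(basicP hS)[le rB]; split; first by apply/prod_leR.
by exists (lh (val ap).1); exact: prod_rE.
Qed.

Lemma prod_moveII ap Au m : moveII ap Au m ->
  moveII (val ap).1 Au.1 ((val m.1).1, m.2.1).
Proof.
move=> [[[n bn] [A [k [l [kl apE mE]]]] lhm] /prod_basic b2].
split=> //; split=> /=.
- by exists n.
- by exists A.1, k, l; split=> //; rewrite ?apE ?mE.
- by move: lhm; rewrite !prod_lh.
Qed.

Lemma moveII_prod ap ap' Au C c :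
  moveII (val ap).1 Au.1 ((val ap').1, C) -> (val ap').2 = rcons (val ap).2 c ->
  moveII ap Au (ap', (C, nth false (val ap').2)).
Proof.
move=> [[[n bn] ini lhm] b2] pE; split=> /=; last exact: prod_basic_nth.
split; [by exists n | | by rewrite !prod_lh].
have [A rA] := r_lh hS (val ap').1.
exists (A, nth false (val ap').2), (lh (val ap).1), (lh (val ap').1); split.
- by rewrite lhm.
- apply: approx_eq; first by rewrite /= (initial_r hS ini rA).
  rewrite /= lh_fst; apply: (@eq_from_nth _ false) => [|i il].
    by rewrite size_mkseq.
  by rewrite nth_mkseq// pE nth_rcons il.
- by rewrite prod_rE.
Qed.

Variable X : set (carrier PS).

Lemma projection_strategyII ap Bu tau : strategyII_ensures ap Bu tau X ->
  exists tau', strategyII_ensures (val ap).1 Bu.1 tau' (fst @` X).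
Proof.
move=> ens.
(* To be legal in the product, a move of I must carry the bits that II has played so far; these are
   read off the last stem. *)
pose last_stem (H : seq (carrier PS)) := if H is [::] then ap else (tau H).1.
pose ext (H : seq (carrier PS)) (y : carrier S) : seq (carrier PS) :=
  rcons H (y, nth false (val (last_stem H)).2).
exists (fun ys => let m := tau (foldl ext [::] ys) in ((val m.1).1, m.2.1)).
move=> y x.
pose H n := foldl ext [::] (mkseq y n).
pose Y n : carrier PS := (y n, nth false (val (last_stem (H n))).2).
have HE n : mkseq Y n = H n.
  by elim: n => [//|n IH]; rewrite mkseqS IH /H foldl_mkseqS.
have [l o] := ens Y.
set x' := (fun n => tau (mkseq Y n.+1)) in l o.
have xE n : x n = ((val (x' n).1).1, (x' n).2.1) by rewrite /x /x' HE.
have stE n : stem (val ap).1 x n = (val (stem ap x' n)).1.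
  by case: n => [//|n]; rewrite -[LHS]/(x n).1 xE.
have sdE n : side Bu.1 x n = (side Bu x' n).1.
  by case: n => [//|n]; rewrite -[LHS]/(x n).2 xE.
have last_stem_rcons h z : last_stem (rcons h z) = (tau (rcons h z)).1.
  by case: h.
have lsE n : last_stem (H n) = stem ap x' n.
  by case: n => [//|n]; rewrite /= /x' HE /H foldl_mkseqS /ext last_stem_rcons.
have lI n : legalI (val ap).1 Bu.1 x y n -> legalI ap Bu x' Y n.
  by rewrite /legalI stE sdE /Y lsE => /prod_basic_nth.
split=> [n ln|ln].
  have : legalII ap x' Y n by apply: l => i /ln /lI.
  by move=> /prod_moveII; rewrite /legalII stE xE.
have [|[B v] oB XB] := o; first by move=> n; exact: lI.
exists B; last by exists (B, v).
by move=> n; rewrite stE -oB /= prod_lh.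
Qed.

Definition prod_follows A ap
    (sigma : seq (approx PS * carrier PS) -> carrier PS) : Prop :=
  exists2 Bu, strategyI_ensures ap Bu sigma (~` X) & leR A (sigma [::]).1.

Lemma mem_bitseqs n (t : seq bool) :
  t \in [seq val s | s <- enum {: n.-tuple bool}] = (size t == n).
Proof.
apply/mapP/idP => [[s _ ->]|tn]; first by rewrite size_tuple.
by exists (Tuple tn) => //; rewrite mem_enum.
Qed.

(** The state assigns a strategy to every way of attaching bits to the current stem. These are
    finitely many, so one move of I can lie below what all of them prescribe. *)
Lemma projection_strategyI a A
    (f0 : approx PS -> seq (approx PS * carrier PS) -> carrier PS) :
  basic a A A ->
  (forall ap, (val ap).1 = a -> prod_follows A ap (f0 ap)) ->
  exists sigma, strategyI_ensures a A sigma (~` (fst @` X)).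
Proof.
move=> AA fol0.
pose Q := ((approx S * carrier S) *
  (approx PS -> seq (approx PS * carrier PS) -> carrier PS))%type.
pose stm (q : Q) := q.1.1; pose mv (q : Q) := q.1.2.
pose good (q : Q) :=
  forall ap, (val ap).1 = stm q -> prod_follows (mv q) ap (q.2 ap).
pose next (q : Q) (m : approx S * carrier S) (q' : Q) :=
  forall ap ap' c, (val ap).1 = stm q -> (val ap').1 = m.1 ->
    (val ap').2 = rcons (val ap).2 c -> exists Cu,
    moveII ap (q.2 ap [::]) (ap', Cu) /\ q'.2 ap' = shift (q.2 ap) (ap', Cu).
apply: (@strategyI_of_machine _ Q stm mv good next ((a, A), f0)) => //.
  move=> q m fol mm.
  pose P t C := forall ap', val ap' = (m.1, t) -> exists sigma,
    prod_follows C ap' sigma /\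
    forall ap c, (val ap).1 = stm q -> t = rcons (val ap).2 c -> exists Cu,
      moveII ap (q.2 ap [::]) (ap', Cu) /\ sigma = shift (q.2 ap) (ap', Cu).
  have Pm t C C' : P t C -> basic m.1 C C' -> P t C'.
    move=> PC CC' ap' /PC[sigma [[Bu ens le] sP]]; exists sigma; split=> //.
    by exists Bu => //; exact: (leR_trans hS CC'.1 le).
  have m2 : basic m.1 m.2 m.2 by exact: (basic_self hS mm.2).
  have [t C|C mC CP] := common_refinement hS m2 Pm
      (L := [seq val s | s <- enum {: (lh m.1).-tuple bool}]).
    rewrite mem_bitseqs => /eqP tl mC.
    have [[ap' ap'E]|nE] := pselect (exists ap', val ap' = (m.1, t)); last first.
      exists C; first exact: (basic_self hS mC).
      by move=> ap' ap'E; case: nE; exists ap'.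
    (* The last bit of [t] belongs to this round. Dropping it gives the unique parent, whose
       strategy is continued. *)
    have [ap [c [apq tE]]] : exists ap c,
        (val ap).1 = stm q /\ t = rcons (val ap).2 c.
      have [W rW] := r_lh hS (stm q).
      exists (@r PS (W, nth false t) (lh (stm q))), (last false t); split=> //=.
      move: tl; rewrite (moveII_lh mm); case/lastP: t {ap' ap'E} => // p c.
      rewrite size_rcons => -[pl]; rewrite last_rcons; congr rcons.
      apply: (@eq_from_nth _ false) => [|i il]; first by rewrite size_mkseq.
      by rewrite nth_mkseq -?pl// nth_rcons il.
    have [Bu ens le] := fol _ apq.
    have mC' : moveII ap (q.2 ap [::]) (ap', (C, nth false (val ap').2)).
      apply: (moveII_prod (c := c)); last by rewrite ap'E.
      rewrite apq ap'E; exact: (moveII_mono hS le mm mC).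
    have ens' := strategyI_shift ens mC'.
    have /prod_basic b0 := strategyI_first ens'.
    exists (shift (q.2 ap) (ap', (C, nth false (val ap').2)) [::]).1.
      by move: b0; rewrite /= ap'E.
    move=> ap2; rewrite -ap'E => /approx_inj ->; eexists; split.
      by eexists; [exact: ens' | exact: leR_refl].
    move=> ap3 c3 ap3q t3E; have -> : ap3 = ap.
      have [p3 _] := rcons_inj (etrans (esym t3E) tE).
      by apply: approx_eq; [rewrite ap3q | exact: p3].
    by exists (C, nth false (val ap').2).
  have /choice[f' f'P] ap' : exists sigma, (val ap').1 = m.1 ->
      prod_follows C ap' sigma /\
      forall ap c, (val ap).1 = stm q -> (val ap').2 = rcons (val ap).2 c ->
      exists Cu,
      moveII ap (q.2 ap [::]) (ap', Cu) /\ sigma = shift (q.2 ap) (ap', Cu).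
    have [ap'E|nE] := pselect ((val ap').1 = m.1); last first.
      by exists (fun=> (C, fun=> false)).
    have [||sigma sP] := CP (val ap').2 _ ap'; last by exists sigma.
      by rewrite mem_bitseqs -lh_fst ap'E.
    by rewrite -ap'E; case: (val ap').
  exists ((m.1, C), f'); split=> //; first by move=> ap' /f'P[].
  by move=> ap ap' c apq /f'P[_]; exact.
move=> x q q00 gq sq mq nq.
have [B oB] : exists B, outcome a x B.
  by apply: (legal_outcome hS (y := fun n => mv (q n))) => n; rewrite -sq.
exists B => // -[[B' v] /= Xv BB']; rewrite {B'}BB' in Xv.
(* If [(B, v)] were in [X], the strategies met along the bits of [v] would be successive remainders
   of a single one, with outcome [(B, v)]. *)
pose b n : approx PS := @r PS (B, v) (lh a + n).
have bq n : (val (b n)).1 = stm (q n) by rewrite /= oB sq.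
have [Bu ens _] := gq 0 (b 0) (bq 0).
have [n|Bv oBv XBv] :=
    strategyI_follow (b := b) (s := fun n => (q n).2 (b n)) ens.
  apply: (nq n _ _ (v (lh a + n))) => //; first by rewrite bq sq.
  by rewrite /= addnS mkseqS.
apply: XBv; suff -> : Bv = (B, v) by [].
apply: (@prod_r_inj (lh a)) => n; rewrite -[RHS]/(b n) -oBv prod_lh.
by congr (@r PS _ (_ + _)); rewrite /= (lh_r hS) addn0.
Qed.

(** For II it suffices to win over one choice of bits attached to [a]. If that fails at all
    refinements, I can refine successively until he wins over each of the finitely many choices. *)
Lemma projection_Ramsey : @Kastanas_Ramsey PS X -> Kastanas_Ramsey (fst @` X).
Proof.
move=> KX A a /(AR_below_basic hS)[A1 AA1].
have A11 := basic_self hS AA1.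
have [[B [B1 [ap [u [tau [apa ens]]]]]]|nII] := pselect (exists B, basic a A1 B /\
    exists ap u tau, (val ap).1 = a /\
      strategyII_ensures ap ((B, u) : carrier PS) tau X).
  exists B; first exact: (basic_trans hS AA1.1 B1).
  by right; rewrite -apa; exact: projection_strategyII ens.
pose P t C := forall ap, val ap = (a, t) -> exists sigma, prod_follows C ap sigma.
have Pm t C C' : P t C -> basic a C C' -> P t C'.
  move=> PC CC' ap /PC[sigma [Bu ens le]]; exists sigma.
  by exists Bu => //; exact: (leR_trans hS CC'.1 le).
have [t C|C mC CP] := common_refinement hS A11 Pm
    (L := [seq val s | s <- enum {: (lh a).-tuple bool}]).
  move=> _ mC.
  have [[ap apE]|nE] := pselect (exists ap, val ap = (a, t)); last first.
    exists C; first exact: (basic_self hS mC).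
    by move=> ap apE; case: nE; exists ap.
  have ap1 : (val ap).1 = a by rewrite apE.
  (* The bits paired with [C] are arbitrary, since the order compares first coordinates only. *)
  have [|[B u] bB] := KX (C, fun=> false) ap.
    exists (lh a); rewrite /lefin /= /prod_lefin apE /=.
    by have /(basicP hS)[_ ->] := mC; exact: lefin_refl.
  have := prod_basic bB; rewrite apE /= => bB'.
  case=> [[sigma ens]|[tau ens]]; last first.
    case: nII; exists B; split; last by exists ap, u, tau.
    exact: (basic_trans hS mC.1 bB').
  have := prod_basic (strategyI_first ens); rewrite apE /= => b0.
  exists (sigma [::]).1; first exact: (basic_trans hS bB'.1 b0).
  move=> ap2; rewrite -apE => /approx_inj ->; exists sigma.
  by exists (B, u) => //; exact: leR_refl.
exists C; first exact: (basic_trans hS AA1.1 mC).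
left; have /choice[f0 f0P] ap : exists sigma,
    (val ap).1 = a -> prod_follows C ap sigma.
  have [apa|nE] := pselect ((val ap).1 = a); last first.
    by exists (fun=> (C, fun=> false)).
  have [||sigma sP] := CP (val ap).2 _ ap; last by exists sigma.
    by rewrite mem_bitseqs -lh_fst apa.
  by rewrite -apa; case: (val ap).
exact: (projection_strategyI (basic_self hS mC) f0P).
Qed.

End Projection.

(** Coding trades the projection along the Baire space for one along the Cantor space, whose bits
    are played in the product game. *)
Lemma Sigma11_Ramsey (S : approx_space) (hS : wA2_space S) n :
  (forall E : set (carrier S * cantor_space),
    Pi11 n.+1 E -> @Kastanas_Ramsey (prod_space S) E) ->
  forall E : set (carrier S), Sigma11 n.+2 E -> Kastanas_Ramsey E.
Proof.
move=> KP E [F /cantor_uniformization[C CP CF] ->].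
by rewrite -CF; apply: (projection_Ramsey hS); exact: KP.
Qed.

Theorem theorem4p5 (S : approx_space) (hS : wA2_space S)
    (hAR : countable [set: approx S]) :
  (forall E : set (carrier S), analytic E -> Kastanas_Ramsey E) /\
  ((forall E : set (carrier S * cantor_space),
      coanalytic E -> @Kastanas_Ramsey (prod_space S) E) ->
    forall E : set (carrier S), Sigma11 2 E -> Kastanas_Ramsey E) /\
  (forall n : nat, (1 <= n)%N ->
    (forall E : set (carrier S * cantor_space),
      Pi11 n E -> @Kastanas_Ramsey (prod_space S) E) ->
    forall E : set (carrier S), Sigma11 n.+1 E -> Kastanas_Ramsey E).
Proof.
split; first exact: analytic_Ramsey.
by split=> [|[//|n] _]; [exact: (Sigma11_Ramsey hS (n := 0)) |
  exact: (Sigma11_Ramsey hS (n := n))].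
Qed.
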